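(* Let $\bar{S}_n(2)$ denote the number of finite sequences $\mathbf{a}=(a_1,\ldots,a_m)$ (of any length $m\ge 1$) of positive integers that are bounded in average by $2$ and satisfy $K(\mathbf{a}) \leq n$. Then for every $\epsilon>0$ there is a constant $c_\epsilon>0$ such that $$\bar{S}_n(2) \geq c_\epsilon\, n^{2\log 2/\log(1+\sqrt{2})-\epsilon}$$ for all sufficiently large $n$.
   Context: A sequence $(a_1,\ldots,a_m)$ of positive integers is bounded in average by $B$ if $\sum_{i=1}^t a_i \leq Bt$ for every $t$ with $1\le t\le m$. The continuant $K(a_1,\ldots,a_m)$ is the denominator of the continued fraction $[0;a_1,\ldots,a_m]$; equivalently, $K(a_1,\ldots,a_m)=q_m$ where $q_{-1}=0$, $q_0=1$ and $q_j=a_jq_{j-1}+q_{j-2}$ for $j\ge1$. *)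

(* Defs.v *)
From mathcomp Require Import all_boot all_order all_algebra finmap.
From mathcomp Require Import all_classical all_reals all_analysis.
From mathcomp Require Import zify.

Set Implicit Arguments.
Unset Strict Implicit.
Unset Printing Implicit Defensive.

Import Order.TTheory GRing.Theory Num.Theory.
Local Open Scope classical_set_scope.
Local Open Scope ring_scope.

(* The sequence (a_1, ..., a_m) is the list a with a_i = nth 0 a (i - 1). *)

Definition positive_seq (a : seq nat) : Prop := forall x, x \in a -> (0 < x)%N.

Definition bounded_in_average (R : realType) (B : R) (a : seq nat) : Prop :=
  forall t, (1 <= t <= size a)%N -> (\sum_(i < t) nth 0%N a i)%:R <= B * t%:R.

(* With p = q_{j-1} and q = q_j, processes the partial quotients
   a_{j+1}, ..., a_m by q_{j+1} = a_{j+1} q_j + q_{j-1} and returns q_m. *)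
Fixpoint continuant_from (p q : nat) (a : seq nat) : nat :=
  if a is x :: a' then continuant_from q (x * q + p)%N a' else q.

Definition continuant (a : seq nat) : nat := continuant_from 0 1 a.

Definition avg_bounded_set (R : realType) (B : R) (n : nat) : set (seq nat) :=
  [set a | [/\ (1 <= size a)%N, positive_seq a, bounded_in_average B a
             & (continuant a <= n)%N]].

(* [fset_set] is the empty set on infinite sets; by [finite_avg_bounded_set]
   below that default value is never used here. *)
Definition Sbar (R : realType) (B : R) (n : nat) : nat :=
  #|` fset_set (avg_bounded_set B n)|%fset.

Lemma continuant_from_size p q a : positive_seq a -> (0 < p)%N -> (0 < q)%N ->
  (size a + q <= continuant_from p q a)%N.
Proof.
elim: a p q => [|x a IH] p q //= pos_a p0 q0.
have x0 : (0 < x)%N by apply: pos_a; rewrite mem_head.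
have pos_a' : positive_seq a by move=> y ya; apply: pos_a; rewrite inE ya orbT.
have : (q <= x * q)%N by rewrite leq_pmull.
have := IH q (x * q + p)%N pos_a' q0; lia.
Qed.

Lemma continuant_from_mem p q a x : positive_seq a -> (0 < q)%N ->
  x \in a -> (x <= continuant_from p q a)%N.
Proof.
elim: a p q => [|y a IH] p q //= pos_a q0.
have y0 : (0 < y)%N by apply: pos_a; rewrite mem_head.
have pos_a' : positive_seq a by move=> z za; apply: pos_a; rewrite inE za orbT.
have yq : (0 < y * q)%N by rewrite muln_gt0 y0.
rewrite inE => /predU1P[->|xa]; last by apply: IH => //; lia.
have : (y <= y * q)%N by rewrite leq_pmulr.
have := @continuant_from_size q (y * q + p)%N a pos_a' q0; lia.
Qed.

Lemma continuant_size a : positive_seq a -> (0 < size a)%N ->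
  (size a <= continuant a)%N.
Proof.
case: a => // x a pos_a _; rewrite /continuant /= muln1 addn0.
have x0 : (0 < x)%N by apply: pos_a; rewrite mem_head.
have pos_a' : positive_seq a by move=> y ya; apply: pos_a; rewrite inE ya orbT.
have := continuant_from_size pos_a' (ltn0Sn 0) x0; lia.
Qed.

Lemma finite_avg_bounded_set (R : realType) (B : R) (n : nat) :
  finite_set (avg_bounded_set B n).
Proof.
pose f (u : {k : 'I_n.+1 & k.-tuple 'I_n.+1}) : seq nat :=
  [seq val i | i <- tagged u].
apply: (@sub_finite_set _ _ (f @` setT)); last by apply: finite_image; exact: finite_finset.
move=> a [sz pos_a _ Kn].
have sn : (size a < n.+1)%N by rewrite ltnS (leq_trans (continuant_size _ _)).
have an x : x \in a -> (x < n.+1)%N.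
  by move=> xa; rewrite ltnS (leq_trans _ Kn) // continuant_from_mem.
have sE : size [seq inord x : 'I_n.+1 | x <- a] == Ordinal sn.
  by rewrite size_map.
exists (Tagged (fun k : 'I_n.+1 => k.-tuple 'I_n.+1) (Tuple sE)) => //.
rewrite /f /= -map_comp -[RHS]map_id; apply/eq_in_map => x /an xn /=.
by rewrite inordK.
Qed.

(* Main.v *)
Require Import Defs.
From mathcomp Require Import all_boot all_order all_algebra.
From mathcomp Require Import all_classical all_reals all_analysis.
From mathcomp Require Import finmap zify ring lra.

(* Write [r = 1 + sqrt 2].  One step [(p, q) -> (q, a q + p)] of the continuant
   recurrence with [p <= q] multiplies the linear form [r q + p] by at most
   [r (sqrt 2) ^ (a - 2)], with equality for [a = 2].  Hence [K(a) <= r ^ m] for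
   every sequence of length [m] and sum at most [2 m].  The sequences of length
   [m] that are bounded in average by [2] are counted by a ballot number, the
   Catalan number of index [m + 1], which is at least [4 ^ m / (m + 2) ^ 2].
   It remains to take the largest [m] with [r ^ m <= n], the polynomial factor
   being absorbed by [n ^ e]. *)

Import Order.TTheory GRing.Theory Num.Theory.
Local Open Scope classical_set_scope.
Local Open Scope ring_scope.

(** * Growth of the continuant in terms of length and sum *)

Section ContinuantBound.
Variable R : realType.
Let s : R := Num.sqrt 2.
Let r : R := 1 + s.

Let s_gt0 : 0 < s. Proof. by rewrite sqrtr_gt0. Qed.

Let s_sqr : s ^+ 2 = 2. Proof. by rewrite sqr_sqrtr. Qed.

(** The factor 2 is [s ^+ 2] moved to the left. Induction on [x] from 2, where equality holds:
    raising [x] by one multiplies the left side by at most [s]. For [x = 1] the gap is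
    [s * (q - p)]. *)
Lemma continuant_step (p q : R) (x : nat) : 0 <= p -> p <= q -> (0 < x)%N ->
  2 * (r * (x%:R * q + p) + q) <= r * s ^+ x * (r * q + p).
Proof.
move=> p0 pq; have q0 : 0 <= q by exact: le_trans pq.
case: x => [//|[_|]].
  (* Here and below, the difference is split off a multiple of [s ^+ 2 - 2], so that [ring] may
     treat [s] as an indeterminate. *)
  rewrite -subr_ge0 expr1 /r.
  have -> : (1 + s) * s * ((1 + s) * q + p) - 2 * ((1 + s) * (1 * q + p) + q)
    = s * (q - p) + (s ^+ 2 - 2) * ((s + 2) * q + p) by ring.
  by rewrite s_sqr subrr mul0r addr0 mulr_ge0 ?subr_ge0// ltW.
elim=> [_|x IH _].
  rewrite s_sqr -subr_ge0 /r.
  have -> : (1 + s) * 2 * ((1 + s) * q + p) - 2 * ((1 + s) * (2 * q + p) + q)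
    = (s ^+ 2 - 2) * (2 * q) by ring.
  by rewrite s_sqr subrr mul0r.
have {}IH := IH isT.
rewrite exprS mulrCA -mulrA.
apply: le_trans (_ : s * (2 * (r * (x.+2%:R * q + p) + q)) <= _).
  rewrite -subr_ge0 /r -(@natr1 R x.+2).
  have -> : s * (2 * ((1 + s) * (x.+2%:R * q + p) + q)) -
      2 * ((1 + s) * ((x.+2%:R + 1) * q + p) + q)
    = 2 * (x%:R * q + p) + (s ^+ 2 - 2) * (2 * (x.+2%:R * q + p)).
    by rewrite -(@natr1 R x.+1) -(@natr1 R x); ring.
  rewrite s_sqr subrr mul0r addr0.
  by rewrite mulr_ge0// addr_ge0// mulr_ge0.
by rewrite ler_pM2l// mulrA.
Qed.

(** Iterates the step, since positive terms preserve [p <= q]; the final form [r q + p] is weakened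
    to [r q]. *)
Lemma continuant_from_le p q a : positive_seq a -> (p <= q)%N ->
  2 ^+ size a * (r * (continuant_from p q a)%:R)
    <= r ^+ size a * s ^+ sumn a * (r * q%:R + p%:R).
Proof.
elim: a p q => [|x a IH] p q pos_a pq /=.
  by rewrite !expr0 !mul1r lerDl.
have x0 : (0 < x)%N by apply: pos_a; rewrite mem_head.
have pos_a' : positive_seq a by move=> y ya; apply: pos_a; rewrite inE ya orbT.
have r0 : 0 < r by rewrite addr_gt0.
have qq : (q <= x * q + p)%N by nia.
rewrite exprS -mulrA.
apply: (le_trans (ler_wpM2l _ (IH _ _ pos_a' qq))) => //.
have pqR : p%:R <= q%:R :> R by rewrite ler_nat.
have := continuant_step _ _ _ (ler0n _ p) pqR x0.
rewrite natrD natrM => /(ler_wpM2l (_ : 0 <= r ^+ size a * s ^+ sumn a)) step.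
rewrite exprS exprD mulrCA.
have -> : r * r ^+ size a * (s ^+ x * s ^+ sumn a) * (r * q%:R + p%:R)
  = r ^+ size a * s ^+ sumn a * (r * s ^+ x * (r * q%:R + p%:R)) by ring.
by apply: step; rewrite mulr_ge0// exprn_ge0// ltW.
Qed.

Lemma continuant_le a : positive_seq a -> (sumn a <= 2 * size a)%N ->
  (continuant a)%:R <= (1 + Num.sqrt 2) ^+ size a :> R.
Proof.
move=> pos_a sum_a; rewrite -/s -/r.
have r0 : 0 < r by rewrite addr_gt0.
have s1 : 1 <= s by move: s_gt0 s_sqr; nra.
have := continuant_from_le 0 1 a pos_a isT.
rewrite mulr1 addr0 mulrCA [leRHS]mulrC ler_pM2l// => le1.
(* The bound on the sum enters here and cancels [2 ^+ size a]. *)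
have le2 : s ^+ sumn a <= 2 ^+ size a by rewrite -s_sqr -exprM ler_weXn2l.
rewrite -(@ler_pM2l _ (2 ^+ size a)) ?exprn_gt0//.
apply: (le_trans le1).
by rewrite mulrC ler_wpM2r// exprn_ge0// ltW.
Qed.

End ContinuantBound.

(** * Counting ballot sequences *)

(* [d] is the slack: the prefixes of length [t] may have sum up to [2 t + d];
   after a first term [d + 2 - j] the remaining slack is [j]. *)
Fixpoint ballot_seqs (m d : nat) : seq (seq nat) :=
  if m is m'.+1 then
    [seq (d.+2 - j)%N :: a | j <- iota 0 d.+2, a <- ballot_seqs m' j]
  else [:: [::]].

Lemma ballot_seqs_uniq m d : uniq (ballot_seqs m d).
Proof.
elim: m d => [//|m IH] d; rewrite [ballot_seqs _ _]/=.
apply: (@allpairs_uniq_dep _ _ _ (fun j a => (d.+2 - j)%N :: a)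
  (iota 0 d.+2)) => [|j _|[j a] [k b]]; [exact: iota_uniq|exact: IH|].
move=> /allpairsPdep[j' [a' [+ _ [? _]]]] /allpairsPdep[k' [b' [+ _ [? _]]]] [+ ->].
(* As [j < d.+2], the subtraction does not truncate and the head determines [j]. *)
by subst j' k'; rewrite !mem_iota => ? ? /= ?; suff -> : j = k by []; lia.
Qed.

Lemma ballot_seqsP m d a : a \in ballot_seqs m d ->
  [/\ size a = m, positive_seq a
    & forall t, (t <= size a)%N -> (\sum_(i < t) nth 0 a i <= 2 * t + d)%N].
Proof.
elim: m d a => [|m IH] d a.
  by rewrite inE => /eqP->; split=> // -[|//]; rewrite big_ord0.
case/allpairsPdep => j [b [+ /IH[sz pos_b sum_b] ->]].
rewrite mem_iota => /andP[_ jd]; split=> [|x|[_|t]]; first by rewrite /= sz.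
- by rewrite inE => /predU1P[->|/pos_b//]; lia.
- by rewrite big_ord0.
- rewrite (_ : \sum_(i < t.+1) _ = d.+2 - j + \sum_(i < t) nth 0 b i)%N.
    by rewrite [size _]/= ltnS => /sum_b; lia.
  by rewrite big_ord_recl.
Qed.

Lemma size_ballot_seqsS m d :
  size (ballot_seqs m.+1 d) = (\sum_(0 <= j < d.+2) size (ballot_seqs m j))%N.
Proof. by rewrite size_allpairs_dep sumnE big_map. Qed.

(** The ballot formula with denominators cleared. Writing N(m, d) for the count, N(m+1, d+1) =
    N(m+1, d) + N(m, d+2) and N(m+1, 0) = N(m, 0) + N(m, 1) drive a double induction. *)
Lemma size_ballot_seqs m d :
  (size (ballot_seqs m d) * (m`! * (m + d).+2`!) = d.+2 * (2 * m + d).+1`!)%N.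
Proof.
elim: m d => [|m IHm] d; first by rewrite !mul1n muln0 !add0n (factS d.+1).
elim: d => [|d IHd].
  have := IHm 0; have := IHm 1.
  rewrite size_ballot_seqsS !big_nat_recr//= big_nil add0n.
  move: (size _) (size _) => u v.
  rewrite mulnS !addn0 !addn1 !addSn add0n (factS m) (factS m.+2).
  rewrite (factS (2 * m).+2) (factS (2 * m).+1).
  move: m`! m.+2`! (2 * m).+1`! => x y z Ev Eu.
  have -> : ((u + v) * (m.+1 * x * (m.+3 * y)) =
    m.+1 * m.+3 * (u * (x * y)) + m.+1 * (v * (x * (m.+3 * y))))%N by ring.
  by rewrite Ev Eu; ring.
have := IHm d.+2.
rewrite size_ballot_seqsS big_nat_recr//= -size_ballot_seqsS.
move: IHd; move: (size _) (size _) => v u.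
rewrite !mulnS !addnS !addSn !add0n (factS m) (factS (m + d).+3).
rewrite (factS (2 * m + d).+3).
move: m`! (m + d).+3`! (2 * m + d).+3`! => x y z Eu Ev.
have -> : ((u + v) * (m.+1 * x * ((m + d).+4 * y)) =
  (m + d).+4 * (u * (m.+1 * x * y)) + m.+1 * (v * (x * ((m + d).+4 * y))))%N by ring.
by rewrite Eu Ev; ring.
Qed.

Lemma size_ballot_seqs0_ge m : (4 ^ m <= (m + 2) ^ 2 * size (ballot_seqs m 0))%N.
Proof.
elim: m => [//|m IH].
(* Ratio of consecutive Catalan numbers; the induction then closes by 4 (m+2)^2 <= 2 (m+3)
   (2m+3). *)
have succ : ((m + 3) * size (ballot_seqs m.+1 0)
    = 2 * (2 * m + 3) * size (ballot_seqs m 0))%N.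
  have := size_ballot_seqs m 0; have := size_ballot_seqs m.+1 0.
  move: (size _) (size _) => u v.
  rewrite !addn0 mulnS !addSn add0n (factS m) (factS m.+2) (factS (2 * m).+2).
  rewrite (factS (2 * m).+1) => Eu Ev.
  have f_gt0 : (0 < m.+1 * (m`! * m.+2`!))%N by rewrite !muln_gt0 !fact_gt0.
  apply/eqP; rewrite -(eqn_pmul2l f_gt0); apply/eqP.
  move: Eu Ev {f_gt0}; move: m`! m.+2`! (2 * m).+1`! => x y z Eu Ev.
  transitivity (v * (m.+1 * x * (m.+3 * y)))%N; first by ring.
  rewrite Eu.
  transitivity (2 * (2 * m + 3) * m.+1 * (u * (x * y)))%N; last by ring.
  by rewrite Ev; ring.
rewrite expnS (leq_trans (leq_mul (leqnn 4) IH))//.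
have -> : (m.+1 + 2 = m + 3)%N by lia.
rewrite expnS expn1 -(mulnA (m + 3)) succ !mulnA leq_mul2r; apply/orP; right; nia.
Qed.

(** * The lower bound for [Sbar] *)

Lemma Sbar_ge (R : realType) m n : (0 < m)%N ->
  (1 + Num.sqrt 2) ^+ m <= n%:R :> R ->
  (size (ballot_seqs m 0) <= Sbar (2 : R) n)%N.
Proof.
move=> m0 mn; rewrite /Sbar.
have <- : #|` [fset a in ballot_seqs m 0]|%fset = size (ballot_seqs m 0).
  by rewrite card_fseq undup_id// ballot_seqs_uniq.
apply/fsubset_leq_card/fsubsetP => a.
rewrite in_fset => /ballot_seqsP[sz pos_a sum_a].
rewrite in_fset_set; last exact: finite_avg_bounded_set.
apply/mem_set; split=> //; first by rewrite sz.
  move=> t /andP[_ /sum_a]; rewrite addn0 => le_t.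
  by rewrite -natrM ler_nat.
rewrite -(ler_nat R) (le_trans _ mn)// -sz continuant_le//.
by rewrite sumnE (big_nth 0) big_mkord -[leqRHS]addn0 sum_a.
Qed.

Theorem theorem1 (R : realType) (e : R) : 0 < e ->
  exists2 c : R, 0 < c &
    \forall n \near \oo,
      c * n%:R `^ (2 * ln 2 / ln (1 + Num.sqrt 2) - e) <= (Sbar (2 : R) n)%:R.
Proof.
move=> e0; set r : R := 1 + Num.sqrt 2; set L := ln r.
have s0 : 0 < Num.sqrt 2 :> R by rewrite sqrtr_gt0.
have s2 : Num.sqrt 2 ^+ 2 = 2 :> R by rewrite sqr_sqrtr.
have r1 : 1 < r by rewrite /r ltrDl.
have r0 : 0 < r by exact: lt_trans r1.
have r3 : r <= 3 by rewrite /r; nra.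
have L0 : 0 < L by rewrite ln_gt0.
pose b := e * L.
have b0 : 0 < b by rewrite mulr_gt0.
(* One factor 4 of 16 comes from [4 ^+ m.+1], the other from [poly_le], as does [b ^+ 2];
   [expR (- (2 * b))] turns [m + 2] into [m]. *)
exists (expR (- (2 * b)) * b ^+ 2 / 16).
  by rewrite divr_gt0// mulr_gt0 ?expR_gt0// exprn_gt0.
near=> n.
(* Ensures [r <= n], hence [0 < m]: only nonempty sequences are counted. *)
have n3 : (3 <= n)%N by near: n; exact: nbhs_infty_ge.
have n0 : 0 < n%:R :> R by rewrite ltr0n; lia.
have rn : r <= n%:R by rewrite (le_trans r3)// ler_nat.
pose m := Num.truncn (ln n%:R / L).
have lnn0 : 0 <= ln n%:R / L.
  by rewrite divr_ge0 ?(ltW L0)// ln_ge0// ler1n; lia.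
have /andP[] := truncn_itv lnn0; rewrite -/m => m_le m_gt.
have m_gt0 : (0 < m)%N.
  by rewrite truncn_gt0 ler_pdivlMr// mul1r ler_ln ?posrE.
rewrite ler_pdivlMr// in m_le; rewrite ltr_pdivrMr// in m_gt.
have rE k : r ^+ k = expR (k%:R * L) by rewrite expRM_natl lnK ?posrE.
have rmn : r ^+ m <= n%:R by rewrite rE -[leRHS]lnK ?posrE// ler_expR.
apply: le_trans (_ : (size (ballot_seqs m 0))%:R <= _); last first.
  by rewrite ler_nat Sbar_ge.
have size_ge : 4 ^+ m <= (m%:R + 2) ^+ 2 * (size (ballot_seqs m 0))%:R :> R.
  by have := size_ballot_seqs0_ge m; rewrite -(ler_nat R) natrM !natrX natrD.
have ln2 : 0 < ln 2 :> R by rewrite ln_gt0// ltr1n.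
(* The main exponent uses [ln n < (m + 1) L], the loss [- e] uses [m L <= ln n]. *)
have pow_le : n%:R `^ (2 * ln 2 / L - e) <= 4 ^+ m.+1 * expR (- (b * m%:R)).
  rewrite /powR gt_eqF// (_ : 4 = expR (2 * ln 2)); last first.
    by rewrite expRM_natl lnK ?posrE// -natrX.
  rewrite -expRM_natl -expRD ler_expR mulrBl lerB//.
    rewrite mulrAC ler_pdivrMr//.
    rewrite [m.+1%:R * _]mulrC -[leRHS]mulrA.
    by apply: ler_wpM2l (ltW m_gt); rewrite mulr_ge0// ltW.
  by rewrite /b -mulrA ler_pM2l// mulrC.
(* Square of [x <= expR x] at [x = b (m + 2) / 2]. *)
have poly_le : b ^+ 2 * (m%:R + 2) ^+ 2 <= 4 * expR (b * (m%:R + 2)).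
  set x := b * (m%:R + 2) / 2.
  have x0 : 0 <= x by rewrite divr_ge0// mulr_ge0// ltW.
  have xE : b * (m%:R + 2) = 2 * x by rewrite /x; field.
  rewrite -exprMn xE exprMn -natrX ler_pM2l// expRM_natl.
  by rewrite lerXn2r ?nnegrE ?expR_ge0// (le_trans _ (expR_ge1Dx x))// lerDr.
set T := (size _)%:R in size_ge *.
have T0 : 0 <= T by exact: ler0n.
have key : b ^+ 2 * 4 ^+ m <= 4 * expR (b * (m%:R + 2)) * T.
  apply: le_trans (ler_wpM2l (exprn_ge0 2 (ltW b0)) size_ge) _.
  by rewrite mulrA ler_wpM2r.
apply: le_trans (ler_wpM2l _ pow_le) _.
  by rewrite divr_ge0// mulr_ge0 ?expR_ge0// exprn_ge0// ltW.
have -> : expR (- (2 * b)) * b ^+ 2 / 16 * (4 ^+ m.+1 * expR (- (b * m%:R)))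
    = b ^+ 2 * 4 ^+ m / (4 * expR (b * (m%:R + 2))).
  rewrite invfM -expRN mulrDr opprD expRD (exprS 4 m) (mulrC b 2).
  by move: (expR _) (expR _) (4 ^+ m) => x y z; field.
by rewrite ler_pdivrMr ?mulr_gt0 ?expR_gt0// [T * _]mulrC.
Unshelve. all: by end_near.
Qed.
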